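(* Let $\alpha\in(0,1]$, let $c_0,c_1\in\mathbb{R}$, and let $x_0$ be an $\alpha$-ordinary point of the equation $$T_\alpha^{x_0}T_\alpha^{x_0}y+p(x)\,T_\alpha^{x_0}y+q(x)\,y=0,$$ that is, $p$ and $q$ are $\alpha$-analytic at $x_0$, with radii of convergence $\delta_1>0$ and $\delta_2>0$ respectively. Put $\rho=\min\{\delta_1,\delta_2\}$. Then there exists a solution of this equation of the form $$y(x)=\sum_{k=0}^{\infty}c_k(x-x_0)^{k\alpha},\qquad c_k\in\mathbb{R},$$ for $x\in(x_0,x_0+\rho)$, whose first two coefficients are the given $c_0,c_1$, and which satisfies the initial conditions $y(x_0)=c_0$ and $(T_\alpha^{x_0}y)(x_0)=\alpha c_1$.
   Context: Left conformable fractional derivative: for $\alpha\in(0,1]$ and a real function $f$ defined on an interval with left endpoint $x_0$ (containing $x_0$), for $x>x_0$ define $$(T_\alpha^{x_0}f)(x)=\lim_{\varepsilon\to0}\frac{f\big(x+\varepsilon(x-x_0)^{1-\alpha}\big)-f(x)}{\varepsilon},$$ and $(T_\alpha^{x_0}f)(x_0)=\lim_{x\to x_0^+}(T_\alpha^{x_0}f)(x)$ when this limit exists. $T_\alpha^{x_0}T_\alpha^{x_0}y$ denotes this derivative applied twice. $\alpha$-analyticity: a real function $f$ is $\alpha$-analytic at $x_0$ if it can be expressed as a series of natural powers of $(x-x_0)^\alpha$, i.e. there are real coefficients $f_k$ and $\delta>0$ such that the series converges and $f(x)=\sum_{k=0}^\infty f_k(x-x_0)^{k\alpha}$ for all $x\in[x_0,x_0+\delta)$;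 $\delta$ (possibly $+\infty$) is called the radius of convergence of the series. Thus $p(x)=\sum_{k\ge0}p_k(x-x_0)^{k\alpha}$ on $[x_0,x_0+\delta_1)$ and $q(x)=\sum_{k\ge0}q_k(x-x_0)^{k\alpha}$ on $[x_0,x_0+\delta_2)$. The point $x_0$ is an $\alpha$-ordinary point of the equation $T_\alpha^{x_0}T_\alpha^{x_0}y+p(x)T_\alpha^{x_0}y+q(x)y=0$ if both coefficient functions $p$ and $q$ are $\alpha$-analytic at $x_0$. *)

(* Defs.v *)
From Stdlib Require Export Reals.
From Coquelicot Require Export Coquelicot.
Open Scope R_scope.

(* [Rpower 0 a] is 1 for every [a] ([ln 0 = 0] in the library), so the power of a
   nonnegative base is redefined, with 0^0 = 1 and 0^a = 0 for a <> 0.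
   Negative bases are never used. *)
Definition rpow (t a : R) : R :=
  if Rlt_dec 0 t then Rpower t a else if Req_dec_T a 0 then 1 else 0.

(* The limit defining (T_alpha^{x0} f)(x), for x > x0. *)
Definition is_conf_derive_gt (alpha x0 : R) (f : R -> R) (x l : R) : Prop :=
  is_lim (fun eps => (f (x + eps * rpow (x - x0) (1 - alpha)) - f x) / eps) 0 l.

(* "(T_alpha^{x0} f)(x) exists and equals l"; at x0 it is the limit from the right of
   T_alpha^{x0} f, represented by g, which must exist on some (x0, x0 + eta). *)
Definition is_conf_derive (alpha x0 : R) (f : R -> R) (x l : R) : Prop :=
  (x0 < x /\ is_conf_derive_gt alpha x0 f x l) \/
  (x = x0 /\
   exists g : R -> R,
     at_right x0 (fun t => is_conf_derive_gt alpha x0 f t (g t)) /\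
     filterlim g (at_right x0) (locally l)).

(* f(x) = sum_k a_k (x - x0)^(k alpha), the series being convergent. *)
Definition is_alpha_series (alpha x0 : R) (a : nat -> R) (x fx : R) : Prop :=
  is_series (fun k : nat => a k * rpow (x - x0) (INR k * alpha)) fx.

(* delta > 0, possibly infinite, is a radius on which f is the sum of such a series. *)
Definition alpha_analytic_radius (alpha x0 : R) (f : R -> R) (delta : Rbar) : Prop :=
  Rbar_lt 0 delta /\
  exists a : nat -> R,
    forall x : R, x0 <= x -> Rbar_lt (x - x0) delta ->
      is_alpha_series alpha x0 a x (f x).

Definition alpha_analytic (alpha x0 : R) (f : R -> R) : Prop :=
  exists delta : Rbar, alpha_analytic_radius alpha x0 f delta.

(* For the equation T T y + p (T y) + q y = 0. *)
Definition alpha_ordinary_point (alpha x0 : R) (p q : R -> R) : Prop :=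
  alpha_analytic alpha x0 p /\ alpha_analytic alpha x0 q.

(* y solves T T y + p (T y) + q y = 0 on (x0, x0 + rho). The derivative at x > x0 only
   depends on values near x, so T T y at x is the derivative of any y1 that equals T y
   on the open interval. *)
Definition conf_ode_solution (alpha x0 : R) (p q : R -> R) (rho : Rbar) (y : R -> R)
    : Prop :=
  exists y1 y2 : R -> R,
    forall x : R, x0 < x -> Rbar_lt (x - x0) rho ->
      is_conf_derive alpha x0 y x (y1 x) /\
      is_conf_derive alpha x0 y1 x (y2 x) /\
      y2 x + p x * y1 x + q x * y x = 0.

(* Main.v *)
Require Import Defs.
From Stdlib Require Import Reals.
From Coquelicot Require Import Coquelicot.
From Stdlib Require Import Lra Lia.
Open Scope R_scope.

(** The substitution [t = (x - x0)^alpha] turns the fractional equation into an ordinary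
    one.  Where [f] is differentiable, its conformable derivative at [x > x0] is
    [(x - x0)^(1 - alpha) * f' x]; hence [T_alpha (Y (t x)) = alpha * Y' (t x)] by the chain
    rule, and [y x = Y (t x)] solves the given equation as soon as
    [Y'' + (P / alpha) Y' + (Q / alpha^2) Y = 0], where [P] and [Q] are the power series with
    the coefficients of [p] and [q].

    So it suffices to reprove the classical theorem at an ordinary point: the coefficients
    [c] determined by [c 0], [c 1] and the recurrence ([frobenius_rec]) give a power series
    that converges wherever those of the equation do ([CV_radius_frobenius]).  If the
    coefficients of the equation are [O(r^-k)] and [0 <= s < r], the recurrence bounds
    [|c (n + 2)| * s^(n + 2)] by [D / (n + 2)] times the maximum of the preceding
    [|c j| * s^j], because the convolution is dominated by a geometric series of ratio
    [s / r] ([frobenius_step]).  As soon as [n + 2 >= D] the maximum stops growing, so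
    [|c k| * s^k] is bounded.

    At [x0] the derivative is the limit of [alpha * Y' (t x)] as [t x] tends to [0], which is
    [alpha * Y' 0 = alpha * c 1] because [Y'] is continuous at [0]. *)

(** * The recurrence for the coefficients *)

(** The coefficient of order [n + 2] which the equation [Y'' + A Y' + B Y = 0] forces on a
    power series with coefficients [u]; only [u 0, ..., u (n + 1)] matter. *)
Definition frobenius_next (A B u : nat -> R) (n : nat) : R :=
  - (PS_mult A (PS_derive u) n + PS_mult B u n) / (INR (S n) * INR (S (S n))).

(** The [n]-th approximation is right up to order [n + 1]: each stage corrects one further
    coefficient. *)
Fixpoint frobenius_approx (A B : nat -> R) (c0 c1 : R) (n : nat) : nat -> R :=
  match n with
  | O => fun k => match k with O => c0 | S _ => c1 end
  | S m => fun k =>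
      if Nat.eqb k (S (S m))
      then frobenius_next A B (frobenius_approx A B c0 c1 m) m
      else frobenius_approx A B c0 c1 m k
  end.

(** The coefficients of the power series solution of [Y'' + A Y' + B Y = 0] with
    [Y 0 = c0] and [Y' 0 = c1]. *)
Definition frobenius_coef (A B : nat -> R) (c0 c1 : R) (k : nat) : R :=
  frobenius_approx A B c0 c1 k k.

Lemma frobenius_next_ext (A B u v : nat -> R) (n : nat) :
  (forall j, (j <= S n)%nat -> u j = v j) ->
  frobenius_next A B u n = frobenius_next A B v n.
Proof.
  intros H. unfold frobenius_next, PS_mult.
  do 2 f_equal. f_equal.
  - apply sum_eq. intros i Hi. unfold PS_derive. rewrite H by lia. reflexivity.
  - apply sum_eq. intros i Hi. rewrite H by lia. reflexivity.
Qed.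

Lemma frobenius_approx_stable (A B : nat -> R) (c0 c1 : R) (k n : nat) :
  (k <= S n)%nat ->
  frobenius_approx A B c0 c1 n k = frobenius_coef A B c0 c1 k.
Proof.
  assert (H : forall m i, (i <= S m)%nat ->
            forall d, frobenius_approx A B c0 c1 (d + m) i = frobenius_approx A B c0 c1 m i).
  { intros m i Hi d. induction d as [|d IH]; [reflexivity|]. simpl.
    destruct (Nat.eqb_spec i (S (S (d + m)))); [lia | exact IH]. }
  intros Hk. unfold frobenius_coef.
  destruct (Nat.eq_dec k (S n)) as [-> | Hne].
  - symmetry. exact (H n (S n) (le_n _) 1%nat).
  - replace n with (n - k + k)%nat by lia. apply H. lia.
Qed.

Lemma frobenius_rec (A B : nat -> R) (c0 c1 : R) (n : nat) :
  let c := frobenius_coef A B c0 c1 in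
  PS_derive (PS_derive c) n
  = PS_opp (PS_plus (PS_mult A (PS_derive c)) (PS_mult B c)) n.
Proof.
  intros c.
  assert (Hc : c (S (S n)) = frobenius_next A B c n).
  { rewrite <- (frobenius_next_ext A B (frobenius_approx A B c0 c1 n)).
    - unfold c. rewrite <- (frobenius_approx_stable A B c0 c1 (S (S n)) (S n)) by lia.
      simpl. rewrite Nat.eqb_refl. reflexivity.
    - intros j Hj. apply frobenius_approx_stable. exact Hj. }
  unfold PS_derive at 1 2. rewrite Hc. unfold frobenius_next, PS_opp, PS_plus.
  change (plus ?a ?b) with (a + b). change (opp ?a) with (- a).
  field. split; apply not_0_INR; lia.
Qed.

(** * Convergence of the solution series *)

Lemma sum_geom_le (sigma : R) (n : nat) :
  0 <= sigma < 1 -> sum_f_R0 (fun j => sigma ^ j) n <= / (1 - sigma).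
Proof.
  intros H. rewrite tech3 by lra.
  apply Rmult_le_reg_r with (1 - sigma); [lra|].
  unfold Rdiv. rewrite Rmult_assoc, Rinv_l by lra.
  pose proof (pow_le sigma (S n) (proj1 H)). lra.
Qed.

(** Convolution with a sequence that is [O(r^-k)], weighted at [s < r]. *)
Lemma PS_mult_weighted_le (a v : nat -> R) (M r s V : R) (n : nat) :
  0 <= s < r ->
  (forall k, Rabs (a k * r ^ k) <= M) ->
  0 <= V ->
  (forall j, (j <= n)%nat -> Rabs (v j) * s ^ j <= V) ->
  Rabs (PS_mult a v n) * s ^ n <= M * V / (1 - s / r).
Proof.
  intros Hs Ha HV Hv.
  assert (Hsig : 0 <= s / r < 1).
  { split; [apply Rdiv_le_0_compat; lra|].
    apply Rmult_lt_reg_r with r; [lra|]. field_simplify; lra. }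
  assert (HM : 0 <= M) by (eapply Rle_trans; [apply Rabs_pos | apply (Ha O)]).
  assert (Hterm : forall j, (j <= n)%nat ->
    Rabs (a j * v (n - j)%nat) * s ^ n <= (s / r) ^ j * (M * V)).
  { intros j Hj.
    replace (s ^ n) with (s ^ j * s ^ (n - j)) by (rewrite <- pow_add; f_equal; lia).
    rewrite Rabs_mult.
    replace (Rabs (a j) * Rabs (v (n - j)%nat) * (s ^ j * s ^ (n - j)))
      with ((Rabs (a j) * s ^ j) * (Rabs (v (n - j)%nat) * s ^ (n - j))) by ring.
    replace ((s / r) ^ j * (M * V)) with (((s / r) ^ j * M) * V) by ring.
    apply Rmult_le_compat.
    - apply Rmult_le_pos; [apply Rabs_pos | apply pow_le; lra].
    - apply Rmult_le_pos; [apply Rabs_pos | apply pow_le; lra].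
    - replace (s ^ j) with ((s / r) ^ j * r ^ j)
        by (rewrite <- Rpow_mult_distr; f_equal; field; lra).
      rewrite (Rmult_comm (Rabs (a j))), Rmult_assoc.
      apply Rmult_le_compat_l; [apply pow_le; lra|].
      specialize (Ha j). rewrite Rabs_mult in Ha.
      rewrite (Rabs_right (r ^ j)) in Ha by (apply Rle_ge, pow_le; lra). lra.
    - apply Hv. lia. }
  unfold PS_mult.
  eapply Rle_trans.
  { apply Rmult_le_compat_r; [apply pow_le; lra | apply Rsum_abs]. }
  rewrite Rmult_comm, scal_sum.
  eapply Rle_trans; [apply sum_Rle; exact Hterm|].
  rewrite <- scal_sum.
  apply Rmult_le_compat_l; [apply Rmult_le_pos; assumption | apply sum_geom_le, Hsig].
Qed.

(** The step [n -> n + 2] gains a factor [1 / (n + 2)]: of the divisor [(n + 1) (n + 2)],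
    one factor is spent on the derivative in [A Y']. *)
Lemma frobenius_step (A B c : nat -> R) (M N r s K : R) (n : nat) :
  0 <= s < r ->
  (forall k, Rabs (A k * r ^ k) <= M) ->
  (forall k, Rabs (B k * r ^ k) <= N) ->
  PS_derive (PS_derive c) n
    = PS_opp (PS_plus (PS_mult A (PS_derive c)) (PS_mult B c)) n ->
  0 <= K ->
  (forall j, (j <= S n)%nat -> Rabs (c j) * s ^ j <= K) ->
  INR (S (S n)) * (Rabs (c (S (S n))) * s ^ S (S n))
    <= (M * s + N * s ^ 2) / (1 - s / r) * K.
Proof.
  intros Hs HA HB Hrec HK Hc.
  assert (Hm : 1 <= INR (S n)) by (rewrite S_INR; pose proof (pos_INR n); lra).
  set (m := INR (S n)) in *.
  assert (Hsig : 0 < 1 - s / r).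
  { assert (s / r < 1); [|lra].
    apply Rmult_lt_reg_r with r; [lra|]. field_simplify; lra. }
  assert (HN : 0 <= N) by (eapply Rle_trans; [apply Rabs_pos | apply (HB O)]).
  (* Here the weight on [c'] is [s^(j+1)], which absorbs one of the two spare powers
     of [s]. *)
  assert (H1 : Rabs (PS_mult A (fun j => s * PS_derive c j) n) * s ^ n
               <= M * (m * K) / (1 - s / r)).
  { apply PS_mult_weighted_le; try assumption.
    - apply Rmult_le_pos; lra.
    - intros j Hj. unfold PS_derive.
      rewrite !Rabs_mult, (Rabs_right s) by lra.
      rewrite (Rabs_right (INR (S j))) by (apply Rle_ge, pos_INR).
      replace (s * (INR (S j) * Rabs (c (S j))) * s ^ j)
        with (INR (S j) * (Rabs (c (S j)) * s ^ S j)) by (simpl; ring).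
      apply Rmult_le_compat.
      + apply pos_INR.
      + apply Rmult_le_pos; [apply Rabs_pos | apply pow_le; lra].
      + apply le_INR. lia.
      + apply Hc. lia. }
  assert (H1' : PS_mult A (fun j => s * PS_derive c j) n
                = s * PS_mult A (PS_derive c) n).
  { unfold PS_mult. rewrite scal_sum. apply sum_eq. intros i _. ring. }
  rewrite H1', Rabs_mult, (Rabs_right s) in H1 by lra.
  assert (H2 : Rabs (PS_mult B c n) * s ^ n <= N * K / (1 - s / r)).
  { apply PS_mult_weighted_le; try assumption. intros j Hj. apply Hc. lia. }
  unfold PS_derive at 1 2 in Hrec. unfold PS_opp, PS_plus in Hrec.
  change (plus ?a ?b) with (a + b) in Hrec. change (opp ?a) with (- a) in Hrec.
  set (d := PS_mult A (PS_derive c) n) in *. set (e := PS_mult B c n) in *.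
  fold m in Hrec.
  apply (f_equal Rabs) in Hrec.
  rewrite Rabs_Ropp, !Rabs_mult in Hrec.
  rewrite (Rabs_right m) in Hrec by lra.
  rewrite (Rabs_right (INR (S (S n)))) in Hrec by (apply Rle_ge, pos_INR).
  set (w := INR (S (S n)) * Rabs (c (S (S n)))) in *.
  pose proof (Rabs_triang d e) as Htri.
  replace (INR (S (S n)) * (Rabs (c (S (S n))) * s ^ S (S n)))
    with (w * (s ^ 2 * s ^ n)) by (unfold w; simpl; ring).
  set (P := s ^ n) in *.
  assert (HP : 0 <= P) by (apply pow_le; lra).
  apply Rmult_le_reg_l with m; [lra|].
  replace (m * (w * (s ^ 2 * P))) with (m * w * (s ^ 2 * P)) by ring.
  rewrite Hrec.
  apply Rle_trans with (s * (s * Rabs d * P) + s ^ 2 * (Rabs e * P)).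
  { replace (s * (s * Rabs d * P) + s ^ 2 * (Rabs e * P))
      with ((Rabs d + Rabs e) * (s ^ 2 * P)) by ring.
    apply Rmult_le_compat_r; [|exact Htri].
    apply Rmult_le_pos; [apply pow2_ge_0 | exact HP]. }
  apply Rle_trans with (s * (M * (m * K) / (1 - s / r)) + s ^ 2 * (m * (N * K / (1 - s / r)))).
  - apply Rplus_le_compat.
    + apply Rmult_le_compat_l; [lra | exact H1].
    + apply Rmult_le_compat_l; [apply pow2_ge_0|].
      assert (0 <= N * K / (1 - s / r)).
      { apply Rdiv_le_0_compat; [apply Rmult_le_pos; assumption | exact Hsig]. }
      nra.
  - right. field. split; [|lra].
    intros H0. unfold Rdiv in Hsig.
    apply (Rmult_lt_compat_r r) in Hsig; [|lra].
    rewrite Rmult_minus_distr_r, Rmult_assoc, Rinv_l in Hsig by lra. lra.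
Qed.

(** Once [n + 2 >= D], each new term is at most the maximum of the preceding ones. *)
Lemma bounded_of_step (u : nat -> R) (D : R) :
  (forall n K, 0 <= K -> (forall j, (j <= S n)%nat -> u j <= K) ->
     INR (S (S n)) * u (S (S n)) <= D * K) ->
  exists K, forall n, u n <= K.
Proof.
  intros Hstep.
  destruct (INR_unbounded D) as [N HN].
  assert (Hmax : exists K, 0 <= K /\ forall j, (j <= S N)%nat -> u j <= K).
  { generalize (S N). intros m. induction m as [|m [K [HK Hm]]].
    - exists (Rabs (u O)). split; [apply Rabs_pos|].
      intros j Hj. replace j with O by lia. apply Rle_abs.
    - exists (Rmax K (u (S m))). split; [eapply Rle_trans; [exact HK | apply Rmax_l]|].
      intros j Hj. destruct (Nat.eq_dec j (S m)) as [-> | Hne]; [apply Rmax_r|].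
      eapply Rle_trans; [apply Hm; lia | apply Rmax_l]. }
  destruct Hmax as [K [HK Hmax]]. exists K.
  intros n. induction n as [n IH] using (well_founded_induction Wf_nat.lt_wf).
  destruct (Compare_dec.le_lt_dec n (S N)) as [Hn | Hn]; [apply Hmax, Hn|].
  destruct n as [|[|n]]; try lia.
  assert (Hb : INR (S (S n)) * u (S (S n)) <= D * K).
  { apply Hstep; [exact HK|]. intros j Hj. apply IH. lia. }
  assert (HD : D <= INR (S (S n))).
  { left. apply Rlt_le_trans with (INR N); [exact HN | apply le_INR; lia]. }
  apply Rmult_le_reg_l with (INR (S (S n))).
  - apply lt_0_INR. lia.
  - eapply Rle_trans; [exact Hb|]. apply Rmult_le_compat_r; assumption.
Qed.

Lemma bounded_inside_CV_radius (a : nat -> R) (r : R) :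
  0 <= r -> Rbar_lt r (CV_radius a) -> exists M, forall n, Rabs (a n * r ^ n) <= M.
Proof.
  intros Hr H.
  assert (Hex : ex_series (fun n => a n * r ^ n)).
  { apply ex_series_Rabs, CV_disk_inside. rewrite Rabs_right by lra. exact H. }
  apply ex_series_lim_0 in Hex.
  destruct (filterlim_bounded (fun n => a n * r ^ n)) as [M HM].
  - exists 0. exact Hex.
  - exists M. exact HM.
Qed.

Lemma CV_radius_frobenius (A B : nat -> R) (c0 c1 r : R) :
  Rbar_le r (CV_radius A) -> Rbar_le r (CV_radius B) ->
  Rbar_le r (CV_radius (frobenius_coef A B c0 c1)).
Proof.
  intros HA HB. set (c := frobenius_coef A B c0 c1).
  apply Rbar_not_lt_le. intros Hlt.
  pose proof (CV_radius_ge_0 c) as H0.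
  destruct (CV_radius_bounded c) as [Hub _].
  destruct (CV_radius c) as [rc| |]; simpl in Hlt, H0; try contradiction.
  set (s := rc + (r - rc) / 3). set (r' := rc + 2 * (r - rc) / 3).
  assert (Hs : 0 <= s < r') by (unfold s, r'; lra).
  assert (Hr' : r' < r) by (unfold r'; lra).
  destruct (bounded_inside_CV_radius A r') as [M HM];
    [lra | apply Rbar_lt_le_trans with r; assumption |].
  destruct (bounded_inside_CV_radius B r') as [N HN];
    [lra | apply Rbar_lt_le_trans with r; assumption |].
  destruct (bounded_of_step (fun n => Rabs (c n) * s ^ n)
              ((M * s + N * s ^ 2) / (1 - s / r'))) as [K HK].
  { intros n K HK Hn. apply frobenius_step with (A := A) (B := B); try assumption.
    apply frobenius_rec. }
  assert (Hle : Rbar_le s rc).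
  { apply Hub. exists K. intros n. rewrite Rabs_mult.
    rewrite (Rabs_right (s ^ n)) by (apply Rle_ge, pow_le; lra). apply HK. }
  simpl in Hle. unfold s in Hle. lra.
Qed.

(** The ordinary equation holds for the sum of the series inside the common disk. *)
Lemma frobenius_ode (A B : nat -> R) (c0 c1 r t : R) :
  Rbar_le r (CV_radius A) -> Rbar_le r (CV_radius B) -> Rabs t < r ->
  let c := frobenius_coef A B c0 c1 in
  PSeries (PS_derive (PS_derive c)) t + PSeries A t * PSeries (PS_derive c) t
    + PSeries B t * PSeries c t = 0.
Proof.
  intros HA HB Ht c.
  pose proof (CV_radius_frobenius A B c0 c1 r HA HB) as Hc. fold c in Hc.
  assert (HtA : Rbar_lt (Rabs t) (CV_radius A)) by (apply Rbar_lt_le_trans with r; assumption).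
  assert (HtB : Rbar_lt (Rabs t) (CV_radius B)) by (apply Rbar_lt_le_trans with r; assumption).
  assert (Htc : Rbar_lt (Rabs t) (CV_radius c)) by (apply Rbar_lt_le_trans with r; assumption).
  assert (Htd : Rbar_lt (Rabs t) (CV_radius (PS_derive c))) by (rewrite CV_radius_derive; exact Htc).
  rewrite (PSeries_ext (PS_derive (PS_derive c)) _ t (frobenius_rec A B c0 c1)). fold c.
  rewrite PSeries_opp, PSeries_plus by (apply ex_pseries_mult; assumption).
  rewrite !PSeries_mult by assumption. ring.
Qed.

(** * The variable t = (x - x0)^alpha *)

Lemma rpow_pos_eq (u a : R) : 0 < u -> rpow u a = Rpower u a.
Proof. intros Hu. unfold rpow. destruct (Rlt_dec 0 u); [reflexivity | contradiction]. Qed.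

Lemma rpow_0_l (a : R) : a <> 0 -> rpow 0 a = 0.
Proof.
  intros Ha. unfold rpow.
  destruct (Rlt_dec 0 0); [lra|]. destruct (Req_dec_T a 0); [contradiction | reflexivity].
Qed.

Lemma rpow_pos (u a : R) : 0 < u -> 0 < rpow u a.
Proof. intros Hu. rewrite rpow_pos_eq by exact Hu. apply exp_pos. Qed.

Lemma rpow_lt (u v a : R) : 0 < a -> 0 < u < v -> rpow u a < rpow v a.
Proof.
  intros Ha Huv. rewrite !rpow_pos_eq by lra. apply Rlt_Rpower_l; lra.
Qed.

Lemma rpow_INR_mult (u a : R) (k : nat) : 0 < u -> rpow u (INR k * a) = rpow u a ^ k.
Proof.
  intros Hu. rewrite !rpow_pos_eq by exact Hu.
  rewrite <- Rpower_pow by apply exp_pos.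
  rewrite Rpower_mult. f_equal. ring.
Qed.

Lemma is_alpha_series_pseries (alpha x0 : R) (a : nat -> R) (x l : R) :
  x0 < x ->
  is_alpha_series alpha x0 a x l <-> is_pseries a (rpow (x - x0) alpha) l.
Proof.
  intros Hx. unfold is_alpha_series, is_pseries.
  assert (H : forall k, a k * rpow (x - x0) (INR k * alpha)
                        = scal (pow_n (rpow (x - x0) alpha) k) (a k)).
  { intros k. rewrite rpow_INR_mult by lra.
    rewrite <- pow_n_pow. apply Rmult_comm. }
  split; apply is_series_ext; intros k; [| symmetry]; apply H.
Qed.

Lemma ex_pseries_CV_radius (a : nat -> R) (t : R) :
  0 <= t -> ex_pseries a t -> Rbar_le t (CV_radius a).
Proof.
  intros Ht Hex. apply Rbar_not_lt_le. intros Hlt.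
  apply (CV_disk_outside a t); [rewrite Rabs_right by lra; exact Hlt|].
  assert (Hs : ex_series (fun n => a n * t ^ n)).
  { apply ex_series_ext with (2 := Hex). intros n.
    rewrite <- pow_n_pow. apply Rmult_comm. }
  exact (ex_series_lim_0 _ Hs).
Qed.

Lemma alpha_series_CV_radius (alpha x0 : R) (a : nat -> R) (f : R -> R) (delta : Rbar) (h : R) :
  (forall x, x0 <= x -> Rbar_lt (x - x0) delta -> is_alpha_series alpha x0 a x (f x)) ->
  0 < h -> Rbar_lt h delta -> Rbar_le (rpow h alpha) (CV_radius a).
Proof.
  intros Ha Hh Hd.
  assert (E : x0 + h - x0 = h) by ring.
  apply ex_pseries_CV_radius; [left; apply rpow_pos, Hh|].
  exists (f (x0 + h)).
  assert (H : is_pseries a (rpow (x0 + h - x0) alpha) (f (x0 + h))).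
  { apply is_alpha_series_pseries; [lra|]. apply Ha; [lra | rewrite E; exact Hd]. }
  rewrite E in H. exact H.
Qed.

Lemma is_derive_rpow (alpha x0 x : R) :
  x0 < x ->
  is_derive (fun z => rpow (z - x0) alpha) x (alpha * Rpower (x - x0) (alpha - 1)).
Proof.
  intros Hx.
  apply is_derive_ext_loc with (fun z => Rpower (z - x0) alpha).
  { assert (He : 0 < x - x0) by lra.
    exists (mkposreal _ He). intros z Hz. symmetry. apply rpow_pos_eq.
    apply Rabs_def2 in Hz. simpl in Hz.
    change (minus z x) with (z - x) in Hz. lra. }
  replace (alpha * Rpower (x - x0) (alpha - 1))
    with (scal 1 (alpha * Rpower (x - x0) (alpha - 1)))
    by apply Rmult_1_l.
  apply (is_derive_comp (fun u => Rpower u alpha) (fun z => z - x0)).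
  - apply is_derive_Reals, derivable_pt_lim_power. lra.
  - auto_derive; [exact I | ring].
Qed.

Lemma rpow_at_right (alpha x0 : R) :
  0 < alpha ->
  filterlim (fun x => rpow (x - x0) alpha) (at_right x0) (locally 0).
Proof.
  intros Ha. apply filterlim_locally. intros [e He].
  assert (Hd : 0 < Rpower e (/ alpha)) by apply exp_pos.
  exists (mkposreal _ Hd). intros x Hx Hlt.
  apply Rabs_def2 in Hx. change (minus x x0) with (x - x0) in Hx. simpl in Hx.
  apply Rabs_def1; change (minus ?a 0) with (a - 0); simpl;
    pose proof (rpow_pos (x - x0) alpha ltac:(lra)); [|lra].
  replace e with (rpow (Rpower e (/ alpha)) alpha).
  - assert (rpow (x - x0) alpha < rpow (Rpower e (/ alpha)) alpha); [|lra].
    apply rpow_lt; lra.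
  - rewrite rpow_pos_eq, Rpower_mult, Rinv_l, Rpower_1 by lra. reflexivity.
Qed.

(** * Conformable derivatives *)

Lemma is_conf_derive_gt_of_derive (alpha x0 : R) (f : R -> R) (x l : R) :
  x0 < x -> is_derive f x l ->
  is_conf_derive_gt alpha x0 f x (l * rpow (x - x0) (1 - alpha)).
Proof.
  intros Hx Hf. unfold is_conf_derive_gt.
  set (k := rpow (x - x0) (1 - alpha)).
  assert (Hd : is_derive (fun e => f (x + e * k)) 0 (l * k)).
  { replace (l * k) with (scal k l) by apply Rmult_comm.
    apply (is_derive_comp f (fun e => x + e * k)).
    - replace (x + 0 * k) with x by ring. exact Hf.
    - auto_derive; [exact I | ring]. }
  apply is_derive_Reals in Hd.
  apply is_lim_spec. intros [e He].
  destruct (Hd e He) as [d H].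
  exists d. intros z Hz Hne.
  apply Rabs_def2 in Hz. change (minus z 0) with (z - 0) in Hz.
  specialize (H z Hne ltac:(apply Rabs_def1; lra)).
  rewrite Rplus_0_l, Rmult_0_l, Rplus_0_r in H. exact H.
Qed.

(** The chain rule: in the variable [t] the conformable derivative is [alpha * d/dt]. *)
Lemma is_conf_derive_gt_comp_rpow (alpha x0 : R) (Y : R -> R) (x l : R) :
  x0 < x -> is_derive Y (rpow (x - x0) alpha) l ->
  is_conf_derive_gt alpha x0 (fun z => Y (rpow (z - x0) alpha)) x (alpha * l).
Proof.
  intros Hx HY.
  replace (alpha * l)
    with (scal (alpha * Rpower (x - x0) (alpha - 1)) l * rpow (x - x0) (1 - alpha)).
  - apply is_conf_derive_gt_of_derive; [exact Hx|].
    apply (is_derive_comp Y (fun z => rpow (z - x0) alpha)); [exact HY|].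
    apply is_derive_rpow, Hx.
  - change (scal ?u ?v) with (u * v).
    rewrite rpow_pos_eq by lra.
    replace (alpha * Rpower (x - x0) (alpha - 1) * l * Rpower (x - x0) (1 - alpha))
      with (alpha * l * (Rpower (x - x0) (alpha - 1) * Rpower (x - x0) (1 - alpha))) by ring.
    rewrite <- Rpower_plus.
    replace (alpha - 1 + (1 - alpha)) with 0 by ring.
    rewrite Rpower_O by lra. ring.
Qed.

Lemma Rbar_lt_between (h : R) (delta1 delta2 : Rbar) :
  Rbar_lt h (Rbar_min delta1 delta2) ->
  exists h', h < h' /\ Rbar_lt h' delta1 /\ Rbar_lt h' delta2.
Proof.
  intros H.
  assert (Hb : exists h', h < h' /\ Rbar_lt h' (Rbar_min delta1 delta2)).
  { destruct (Rbar_min delta1 delta2) as [d| |]; simpl in H; try contradiction.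
    - exists ((h + d) / 2). simpl. lra.
    - exists (h + 1). simpl. split; [lra | exact I]. }
  destruct Hb as [h' [H1 H2]]. exists h'. split; [exact H1|].
  split; eapply Rbar_lt_le_trans; try exact H2; [apply Rbar_min_l | apply Rbar_min_r].
Qed.

Theorem theorem3p1 :
  forall (alpha x0 c0 c1 : R) (p q : R -> R) (delta1 delta2 : Rbar),
    0 < alpha <= 1 ->
    alpha_ordinary_point alpha x0 p q ->
    alpha_analytic_radius alpha x0 p delta1 ->
    alpha_analytic_radius alpha x0 q delta2 ->
    exists (y : R -> R) (c : nat -> R),
      c 0%nat = c0 /\
      c 1%nat = c1 /\
      (forall x : R, x0 < x -> Rbar_lt (x - x0) (Rbar_min delta1 delta2) ->
         is_alpha_series alpha x0 c x (y x)) /\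
      conf_ode_solution alpha x0 p q (Rbar_min delta1 delta2) y /\
      y x0 = c0 /\
      is_conf_derive alpha x0 y x0 (alpha * c1).
Proof.
  intros alpha x0 c0 c1 p q delta1 delta2 Halpha _ [Hd1 [a Ha]] [Hd2 [b Hb]].
  set (A := PS_scal (/ alpha) a). set (B := PS_scal (/ alpha ^ 2) b).
  set (c := frobenius_coef A B c0 c1).
  set (t := fun x => rpow (x - x0) alpha).
  (* The series of [p] and [q] still converge at some larger point of the interval; so
     [t x] lies strictly inside their disks of convergence. *)
  assert (Hrad : forall x, x0 < x -> Rbar_lt (x - x0) (Rbar_min delta1 delta2) ->
    exists r, 0 < t x < r /\ Rbar_le r (CV_radius a) /\ Rbar_le r (CV_radius b)).
  { intros x Hx Hlt.
    destruct (Rbar_lt_between _ _ _ Hlt) as [h [Hh [H1 H2]]].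
    exists (rpow h alpha). split; [split; [apply rpow_pos; lra | apply rpow_lt; lra]|].
    split.
    - apply (alpha_series_CV_radius alpha x0 a p delta1); try assumption. lra.
    - apply (alpha_series_CV_radius alpha x0 b q delta2); try assumption. lra. }
  assert (HCA : CV_radius A = CV_radius a)
    by (apply CV_radius_scal, Rinv_neq_0_compat; lra).
  assert (HCB : CV_radius B = CV_radius b)
    by (apply CV_radius_scal, Rinv_neq_0_compat, pow_nonzero; lra).
  assert (Hin : forall x, x0 < x -> Rbar_lt (x - x0) (Rbar_min delta1 delta2) ->
    Rbar_lt (Rabs (t x)) (CV_radius c)).
  { intros x Hx Hlt. destruct (Hrad x Hx Hlt) as [r [Ht [H1 H2]]].
    rewrite Rabs_right by lra. apply Rbar_lt_le_trans with r; [exact (proj2 Ht)|].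
    apply CV_radius_frobenius; [rewrite HCA | rewrite HCB]; assumption. }
  assert (Hy : forall x, x0 < x -> Rbar_lt (x - x0) (Rbar_min delta1 delta2) ->
    is_conf_derive_gt alpha x0 (fun z => PSeries c (t z)) x
      (alpha * PSeries (PS_derive c) (t x))).
  { intros x Hx Hlt. apply (is_conf_derive_gt_comp_rpow alpha x0 (PSeries c)); [exact Hx|].
    apply is_derive_PSeries, Hin; assumption. }
  assert (Ht0 : t x0 = 0)
    by (unfold t; replace (x0 - x0) with 0 by ring; apply rpow_0_l; lra).
  exists (fun x => PSeries c (t x)), c.
  split; [reflexivity|]. split; [reflexivity|]. split; [|split; [|split]].
  - intros x Hx Hlt. apply is_alpha_series_pseries; [exact Hx|].
    apply PSeries_correct, CV_radius_inside, Hin; assumption.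
  - exists (fun x => alpha * PSeries (PS_derive c) (t x)),
      (fun x => alpha * (alpha * PSeries (PS_derive (PS_derive c)) (t x))).
    intros x Hx Hlt. split; [left; split; [exact Hx | apply Hy; assumption]|]. split.
    + left. split; [exact Hx|].
      apply (is_conf_derive_gt_comp_rpow alpha x0
               (fun s => alpha * PSeries (PS_derive c) s)); [exact Hx|].
      apply (is_derive_scal (PSeries (PS_derive c))), is_derive_PSeries.
      rewrite CV_radius_derive. apply Hin; assumption.
    + destruct (Hrad x Hx Hlt) as [r [Ht [H1 H2]]].
      assert (Hode := frobenius_ode A B c0 c1 r (t x)). fold c in Hode.
      rewrite HCA, HCB in Hode. rewrite Rabs_right in Hode by lra.
      specialize (Hode H1 H2 (proj2 Ht)). cbv zeta in Hode.
      assert (Hp : p x = PSeries a (t x)).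
      { symmetry. apply is_pseries_unique, is_alpha_series_pseries; [exact Hx|].
        apply Ha; [lra|]. eapply Rbar_lt_le_trans; [exact Hlt | apply Rbar_min_l]. }
      assert (Hq : q x = PSeries b (t x)).
      { symmetry. apply is_pseries_unique, is_alpha_series_pseries; [exact Hx|].
        apply Hb; [lra|]. eapply Rbar_lt_le_trans; [exact Hlt | apply Rbar_min_r]. }
      unfold A, B in Hode. rewrite !PSeries_scal in Hode.
      rewrite Hp, Hq.
      rewrite <- (Rmult_0_r (alpha ^ 2)), <- Hode. field. lra.
  - rewrite Ht0, PSeries_0. reflexivity.
  - right. split; [reflexivity|].
    exists (fun x => alpha * PSeries (PS_derive c) (t x)).
    assert (H0 : Rbar_lt 0 (Rbar_min delta1 delta2))
      by (apply Rbar_min_case; assumption).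
    destruct (Rbar_lt_between _ _ _ H0) as [h [Hh [H1 H2]]].
    assert (Hhm : Rbar_lt h (Rbar_min delta1 delta2))
      by (apply Rbar_min_case; assumption).
    split.
    + exists (mkposreal _ Hh). intros x Hx Hlt.
      apply Rabs_def2 in Hx. change (minus x x0) with (x - x0) in Hx. simpl in Hx.
      apply Hy; [exact Hlt|]. apply Rbar_lt_trans with h; [simpl; lra | exact Hhm].
    + assert (Hval : c1 = PSeries (PS_derive c) 0)
        by (rewrite PSeries_0; unfold PS_derive; simpl; symmetry; apply Rmult_1_l).
      rewrite Hval.
      apply (filterlim_comp _ _ _ t (fun s => alpha * PSeries (PS_derive c) s) _ (locally 0)).
      * apply rpow_at_right. lra.
      * apply (continuous_scal_r alpha (PSeries (PS_derive c))).
        apply continuity_pt_filterlim, PSeries_continuity.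
        rewrite CV_radius_derive, Rabs_R0.
        apply Rbar_le_lt_trans with (Rabs (t (x0 + h))); [apply Rabs_pos|].
        apply Hin; [lra|]. replace (x0 + h - x0) with h by ring. exact Hhm.
Qed.
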